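(* The set $\mathfrak M^{\boldsymbol\sigma}(\mathbf A,\mathbf a,\mathbf g)$ is vaguely compact for any $\boldsymbol\sigma=(\sigma^i)_{i\in I}\in\mathfrak C(\mathbf A)$ possessing the property $$\langle g_i,\sigma^i\rangle=\int g_i\,d\sigma^i<\infty\quad\text{for all }i\in I.$$
   Context: $X$ is a locally compact Hausdorff space with a strictly positive definite kernel $\kappa$: a symmetric lower semicontinuous $\kappa:X\times X\to(-\infty,\infty]$, nonnegative unless $X$ is compact, such that $\kappa(\mu,\mu)=\iint\kappa\,d\mu\,d\mu\ge0$ for every signed Radon measure $\mu$ for which it is defined, with equality only for $\mu=0$. Capacity: $c_\kappa(Q)=[\inf\kappa(\mu,\mu)]^{-1}$ over positive Radon measures $\mu$ of finite energy carried by $Q$ with $\mu(Q)=1$. $\mathbf A=(A_i)_{i\in I}$ is a generalized condenser in $X$: $I$ is finite, the $A_i\subset X$ are nonempty closed sets with prescribed signs $s_i=\pm1$, $c_\kappa(A_i)>0$, and $c_\kappa(A^+\cap A^-)=0$ where $A^\pm=\bigcup_{s_i=\pm1}A_i$. $\mathfrak M^+(\mathbf A)=\prod_{i\in I}\mathfrak M^+(A_i)$, where $\mathfrak M^+(A_i)$ is the set of positive Radon measures on $X$ supported by $A_i$. The vague topology on $\mathfrak M^+(\mathbf A)$ is the product topology, each $\mathfrak M^+(A_i)$ carrying the topology of pointwise convergence on continuous real functions on $X$ with compact support. $\mathbf a=(a_i)_{i\in I}$ with $a_i>0$; $\mathbf g=(g_i)_{i\in I}$ with $g_i:X\to(0,\infty)$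 continuous and $\inf_Xg_i>0$. $\mathfrak C(\mathbf A)$ is the set of $\boldsymbol\sigma\in\mathfrak M^+(\mathbf A)$ with $\int g_i\,d\sigma^i>a_i$ and support of $\sigma^i$ equal to $A_i$ for all $i\in I$. $\mathfrak M^{\boldsymbol\sigma}(\mathbf A,\mathbf a,\mathbf g)$ is the set of $\boldsymbol\mu=(\mu^i)_{i\in I}\in\mathfrak M^+(\mathbf A)$ with $\mu^i\le\sigma^i$ (i.e. $\sigma^i-\mu^i$ is a positive measure) and $\int g_i\,d\mu^i=a_i$ for all $i\in I$. *)

(* Defs.v *)
From HB Require Import structures.
From mathcomp Require Import all_boot all_order all_algebra.
From mathcomp Require Import all_classical all_reals all_analysis.

Set Implicit Arguments.
Unset Strict Implicit.
Unset Printing Implicit Defensive.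

Import Order.TTheory GRing.Theory Num.Theory.
Import numFieldNormedType.Exports.

Local Open Scope classical_set_scope.
Local Open Scope ring_scope.
Local Open Scope ereal_scope.

(* The library's measurable types are pointed, so X is taken pointed, that is,
   nonempty; this is no restriction as soon as a nonempty A_i is given. *)
Definition borel (X : ptopologicalType) := g_sigma_algebraType (@open X).

HB.instance Definition _ (X : ptopologicalType) := Measurable.on (borel X).

Section RadonMeasures.
Context (R : realType) (X : ptopologicalType).

(* Positive Radon measures on a locally compact Hausdorff space, i.e. positive
   linear functionals on C_c(X), are identified through the Riesz representation
   theorem with the Borel measures that are finite on compact sets, outer regular
   on Borel sets and inner regular on open sets. No sigma-finiteness is assumed.
   Only the values on Borel sets matter. *)
Record is_radon (mu : {measure set (borel X) -> \bar R}) : Prop := IsRadon {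
  radon_compact_fin : forall K : set X, compact K -> mu K < +oo;
  radon_outer_regular : forall B : set (borel X), measurable B ->
    mu B = ereal_inf [set mu U | U in [set U : set X | open U /\ B `<=` U]];
  radon_inner_regular : forall U : set X, open U ->
    mu U = ereal_sup [set mu K | K in [set K : set X | compact K /\ K `<=` U]] }.

Record radonMeasure : Type := RadonMeasure {
  radon_measure :> {measure set (borel X) -> \bar R};
  radonP : is_radon radon_measure }.

HB.instance Definition _ := gen_eqMixin radonMeasure.
HB.instance Definition _ := gen_choiceMixin radonMeasure.

Definition Cc : Type :=
  {f : X -> R | continuous f /\ compact (closure [set x | f x != 0%R])}.

Definition radon_eval (mu : radonMeasure) : prod_topology (fun _ : Cc => R) :=
  fun f => (\int[mu]_x sval f x)%R.

(* The vague topology: the initial topology for mu |-> (f |-> \int f dmu), where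
   the functions on Cc carry the topology of pointwise convergence. *)
HB.instance Definition _ :=
  Topological.copy radonMeasure (initial_topology radon_eval).

Definition radon_le (mu nu : radonMeasure) : Prop :=
  forall B : set (borel X), measurable B -> mu B <= nu B.

Definition radon_eq0 (mu : radonMeasure) : Prop := mu setT = 0.

Definition radon_support (mu : radonMeasure) : set X :=
  [set x | forall U : set X, open_nbhs x U -> 0 < mu U].

(* Q^c is locally mu-negligible; for closed Q this says mu (Q^c) = 0. *)
Definition carried_by (mu : radonMeasure) (Q : set X) : Prop :=
  forall K : set X, compact K -> mu.-negligible (K `\` Q : set (borel X)).

Section Kernel.
Variable kappa : X * X -> \bar R.

Record is_kernel : Prop := IsKernel {
  kernel_sym : forall x y, kappa (x, y) = kappa (y, x);
  kernel_lsc : lower_semicontinuous kappa;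
  kernel_gtNy : forall x y, -oo < kappa (x, y);
  kernel_ge0 : ~ compact [set: X] -> forall x y, 0 <= kappa (x, y) }.

Definition mutual_energy (mu nu : radonMeasure) : \bar R :=
  \int[nu]_y \int[mu]_x kappa (x, y).

(* A real-valued signed Radon measure is given by its Jordan decomposition
   (mup, mum): two positive Radon measures, possibly both of infinite mass, whose
   infimum in the lattice of Radon measures is zero. *)
Definition jordan_pair (mup mum : radonMeasure) : Prop :=
  forall nu : radonMeasure,
    radon_le nu mup -> radon_le nu mum -> radon_eq0 nu.

(* Integrals of kappa against the positive and the negative part of
   (mup - mum) \x (mup - mum). *)
Definition energy_pos (mup mum : radonMeasure) : \bar R :=
  mutual_energy mup mup + mutual_energy mum mum.

Definition energy_neg (mup mum : radonMeasure) : \bar R :=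
  mutual_energy mup mum + mutual_energy mum mup.

Definition signed_energy_defined (mup mum : radonMeasure) : Prop :=
  (energy_pos mup mum \is a fin_num) \/ (energy_neg mup mum \is a fin_num).

Definition signed_energy (mup mum : radonMeasure) : \bar R :=
  energy_pos mup mum - energy_neg mup mum.

Definition strictly_positive_definite : Prop :=
  forall mup mum : radonMeasure, jordan_pair mup mum ->
    signed_energy_defined mup mum ->
    0 <= signed_energy mup mum /\
    (signed_energy mup mum = 0 -> radon_eq0 mup /\ radon_eq0 mum).

(* inve 0 = +oo and inve +oo = 0, and the infimum of the empty set is +oo.
   Only used for closed, hence Borel, Q. *)
Definition capacity (Q : set X) : \bar R :=
  inve (ereal_inf [set mutual_energy mu mu | mu in
    [set mu : radonMeasure | mutual_energy mu mu \is a fin_num /\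
                             carried_by mu Q /\ mu Q = 1]]).

Definition signed_union (I : finType) (A : I -> set X) (s : I -> int) (e : int) :
    set X := \bigcup_(i in [set i | s i = e]) A i.

Record generalized_condenser (I : finType) (A : I -> set X) (s : I -> int) :
    Prop := GeneralizedCondenser {
  condenser_nonempty : forall i, A i !=set0;
  condenser_closed : forall i, closed (A i);
  condenser_sign : forall i, s i = 1%R \/ s i = (-1)%R;
  condenser_capacity : forall i, 0 < capacity (A i);
  condenser_cap :
    capacity (signed_union A s 1%R `&` signed_union A s (-1)%R) = 0 }.

End Kernel.

(* Families of positive Radon measures with the product of the vague topologies;
   the sets below are subsets of this space, with the induced topology. *)
Definition radonFamily (I : finType) := prod_topology (fun _ : I => radonMeasure).

HB.instance Definition _ (I : finType) := Topological.on (radonFamily I).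

Section Families.
Context (I : finType) (A : I -> set X) (a : I -> R) (g : I -> X -> R).

Definition condenser_measures : set (radonFamily I) :=
  [set mu | forall i, radon_support (mu i) `<=` A i].

Definition constraints : set (radonFamily I) :=
  [set sigma | condenser_measures sigma /\
    forall i, (a i)%:E < \int[sigma i]_x (g i x)%:E /\
              radon_support (sigma i) = A i].

Definition constrained_measures (sigma : radonFamily I) : set (radonFamily I) :=
  [set mu | condenser_measures mu /\
    forall i, radon_le (mu i) (sigma i) /\
              \int[mu i]_x (g i x)%:E = (a i)%:E].

End Families.
End RadonMeasures.

Arguments radonFamily : clear implicits.

(* Main.v *)
Require Import Defs.
From HB Require Import structures.
From mathcomp Require Import all_boot all_order all_algebra.
From mathcomp Require Import all_classical all_reals all_analysis.
From mathcomp Require Import measurable_realfun lra.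

Set Implicit Arguments.
Unset Strict Implicit.
Unset Printing Implicit Defensive.

Import Order.TTheory GRing.Theory Num.Theory.
Import numFieldNormedType.Exports.

Local Open Scope classical_set_scope.
Local Open Scope ring_scope.
Local Open Scope ereal_scope.

(* By Tychonoff it suffices to treat one measure at a time. The measures
   nu <= sigma^i, where sigma^i has finite mass because g_i is bounded below, even
   have setwise limits along an ultrafilter: the limit set function is additive
   and dominated by the finite measure sigma^i, hence is countably additive and
   inherits regularity from sigma^i, so the Riesz representation theorem is not
   needed. Setwise convergence together with domination gives convergence of the
   integrals of every sigma^i-integrable function, in particular of the functions
   in C_c(X) and of g_i; thus the mass constraint passes to the limit. *)

Lemma ultra_cvg_compact (T : Type) (U : topologicalType) (F : set_system T)
    (f : T -> U) (K : set U) :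
  UltraFilter F -> compact K -> (\forall x \near F, K (f x)) ->
  exists2 p, K p & f x @[x --> F] --> p.
Proof.
move=> FU cK FK.
have [p [Kp clp]] := cK (f @ F) _ FK; exists p => // V Vp /=.
(* Otherwise the preimage of the complement of [V] is in [F], and the cluster point [p] forces [V]
   to meet its complement. *)
case: (in_ultra_setVsetC (f @^-1` V) FU) => // FV.
by have [q [+ Vq]] := clp (~` V) V FV Vp.
Qed.

(** * Set functions dominated by a finite measure *)

Section DominatedLimit.
Context d (T : measurableType d) (R : realType).
Implicit Types mu nu sigma : {measure set T -> \bar R}.

Definition measure_le_on mu nu := forall B, measurable B -> mu B <= nu B.

Lemma dominated_fin_num mu sigma B : measure_le_on mu sigma ->
  sigma setT < +oo -> measurable B -> mu B \is a fin_num.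
Proof.
move=> le_mu sfin mB; rewrite ge0_fin_numE//.
rewrite (le_lt_trans (le_mu _ mB))// (le_lt_trans _ sfin)//.
by rewrite le_measure ?inE.
Qed.

(** Both sides are the measures of [B] minus [A], by finiteness. Hence any approximation of a set
    with small [sigma]-error is at least as good for [mu]. *)
Lemma dominated_diff mu sigma A B : measure_le_on mu sigma ->
  sigma setT < +oo -> measurable A -> measurable B -> A `<=` B ->
  mu B - mu A <= sigma B - sigma A.
Proof.
move=> le_mu sfin mA mB AB.
have fin nu : measure_le_on nu sigma -> nu B - nu A = nu (B `\` A).
  move=> le_nu; rewrite measureD ?setIidr//.
  by rewrite ltey_eq (dominated_fin_num le_nu).
by rewrite !fin//; apply: le_mu; exact: measurableD.
Qed.

(* A finitely additive set function below a finite measure is continuous at the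
   empty set, hence countably additive. *)
Lemma dominated_additive_measure sigma (l : set T -> R) :
  sigma setT < +oo -> (forall B, (0 <= l B)%R) -> l set0 = 0%R ->
  (forall A B, measurable A -> measurable B -> A `&` B = set0 ->
    l (A `|` B) = (l A + l B)%R) ->
  (forall B, measurable B -> (l B)%:E <= sigma B) ->
  exists mu, forall B, mu B = (l B)%:E.
Proof.
move=> sfin l0 lset0 lU lsig.
have sum_l (F : nat -> set T) n : (forall i, measurable (F i)) ->
    trivIset setT F ->
    (\sum_(0 <= i < n) l (F i) = l (\big[setU/set0]_(i < n) F i))%R.
  move=> mF tF; elim: n => [|n IHn]; first by rewrite big_nil big_ord0.
  rewrite big_nat_recr//= big_ord_recr/= lU ?IHn//; first exact: bigsetU_measurable.
  rewrite big_distrl/= big1// => i _.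
  apply: contrapT => /eqP/set0P ne; have := tF i n I I ne.
  by apply/eqP; rewrite neq_ltn ltn_ord.
pose mu B := (l B)%:E.
have mu0 : mu set0 = 0 by rewrite /mu lset0.
have muge0 B : 0 <= mu B by rewrite lee_fin.
have mu_sigma : semi_sigma_additive mu.
  move=> F mF tF mUF.
  have sigma_fin B : measurable B -> sigma B \is a fin_num.
    exact: dominated_fin_num.
  have s_cvg := measure_semi_sigma_additive F mF tF mUF (s := sigma).
  rewrite /mu.
  have cvg_diff : sigma (\bigcup_n F n) - \sum_(0 <= i < n) sigma (F i)
      @[n --> \oo] --> 0.
    rewrite -[X in _ --> X](subee (sigma_fin _ mUF)); apply: cvgeB => //.
    - by rewrite fin_num_adde_defr// sigma_fin.
    - exact: cvg_cst.
  have lower : (l (\bigcup_n F n))%:E - (sigma (\bigcup_n F n) -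
      \sum_(0 <= i < n) sigma (F i)) @[n --> \oo] --> (l (\bigcup_n F n))%:E.
    rewrite -[X in _ --> X]sube0; apply: cvgeB => //; exact: cvg_cst.
  (* The partial sums lie between [l] of the union minus the [sigma]-mass of the remaining tail,
     which vanishes in the limit, and [l] of the union. *)
  apply: (squeeze_cvge _ lower (cvg_cst _)).
  apply: nearW => n.
  set Un := \big[setU/set0]_(i < n) F i.
  have mUn : measurable Un by exact: bigsetU_measurable.
  have UnU : Un `<=` \bigcup_n F n.
    by rewrite /Un -bigcup_mkord => x [i _ Fx]; exists i.
  have mD : measurable (\bigcup_n F n `\` Un) by exact: measurableD.
  have splitU : l (\bigcup_n F n) = (l Un + l (\bigcup_n F n `\` Un))%R.
    by rewrite -lU// ?setDIK// setDUK.
  have -> : \sum_(0 <= i < n) sigma (F i) = sigma Un.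
    by rewrite big_mkord measure_bigsetU.
  have -> : \sum_(0 <= i < n) (l (F i))%:E = (l Un)%:E.
    by rewrite sumEFin sum_l.
  have -> : sigma (\bigcup_n F n) = sigma Un + sigma (\bigcup_n F n `\` Un).
    by rewrite -measureU ?setDIK// setDUK.
  rewrite addeAC subee ?sigma_fin// add0e splitU lee_fin lerDl l0 andbT.
  rewrite leeBlDr ?sigma_fin// EFinD leeD2l//.
  exact: lsig.
pose m := isMeasure.Build d T R mu mu0 muge0 mu_sigma.
by pose M : {measure set T -> \bar R} := HB.pack mu m; exists M.
Qed.

End DominatedLimit.

(** * Setwise limits along an ultrafilter *)

Section SetwiseLimit.
Context d (T : measurableType d) (R : realType) (M : Type).
Variables (sigma : {measure set T -> \bar R}) (nu : M -> {measure set T -> \bar R}).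
Hypothesis sigma_fin : sigma setT < +oo.
Implicit Types (F : set_system M) (mu : {measure set T -> \bar R}).

(** Each value [nu i B] lies in the compact interval from 0 to [sigma B], so the ultrafilter selects
    a limit. Additivity passes to the limit, and domination by [sigma] upgrades it to countable
    additivity. *)
Lemma ultra_setwise_limit F : UltraFilter F ->
  (\forall i \near F, measure_le_on (nu i) sigma) ->
  exists2 mu, measure_le_on mu sigma &
    forall B, measurable B -> fine (nu i B) @[i --> F] --> fine (mu B).
Proof.
move=> FU Fle; have FP : ProperFilter F by exact: ultra_proper.
(* Non-measurable sets get the default value 0, so that [l] is nonnegative on all sets. *)
have /choice [l lP] B : exists r : R, [/\ (0 <= r)%R,
    measurable B -> r%:E <= sigma B,
    measurable B -> fine (nu i B) @[i --> F] --> r & ~ measurable B -> r = 0%R].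
  have [mB|nmB] := pselect (measurable B); last by exists 0%R.
  have sB : sigma B \is a fin_num by exact: (dominated_fin_num (mu := sigma)).
  have [] := @ultra_cvg_compact _ _ F (fun i => fine (nu i B))
    `[0%R, fine (sigma B)]%classic FU.
  - exact: segment_compact.
  - apply: filterS Fle => i le_nu /=.
    rewrite in_itv/= fine_ge0//= fine_le//; last exact: le_nu.
    exact: dominated_fin_num le_nu _ _.
  - move=> r /=; rewrite in_itv/= => /andP[r0 rs] cr; exists r; split=> // _.
    by rewrite -(fineK sB) lee_fin.
have lU A B : measurable A -> measurable B -> A `&` B = set0 ->
    l (A `|` B) = (l A + l B)%R.
  move=> mA mB AB0; have mAB : measurable (A `|` B) by exact: measurableU.
  have [_ _ /(_ mA) cA _] := lP A; have [_ _ /(_ mB) cB _] := lP B.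
  have [_ _ /(_ mAB) cAB _] := lP (A `|` B).
  apply: (cvg_unique _ cAB) => //.
  apply: cvg_trans (cvgD cA cB); apply: near_eq_cvg.
  apply: filterS Fle => i le_nu.
  by rewrite measureU// fineD// (dominated_fin_num le_nu).
have l0 : l set0 = 0%R.
  (* Additivity on two empty sets says that the value is twice itself. *)
  by have := lU _ _ measurable0 measurable0 (setI0 _); rewrite setU0; lra.
have [mu muE] := dominated_additive_measure sigma_fin
  (fun B => let: And4 h _ _ _ := lP B in h) l0 lU
  (fun B => let: And4 _ h _ _ := lP B in h).
exists mu => B mB; rewrite muE; first by case: (lP B) => _ + _ _; exact.
by case: (lP B) => _ _ + _; exact.
Qed.

(** * From setwise convergence to convergence of integrals *)

Variables (F : set_system M) (mu : {measure set T -> \bar R}).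
Hypothesis FF : ProperFilter F.
Hypothesis nu_le : \forall i \near F, measure_le_on (nu i) sigma.
Hypothesis mu_le : measure_le_on mu sigma.
Hypothesis nu_mu :
  forall B, measurable B -> fine (nu i B) @[i --> F] --> fine (mu B).

Import HBNNSimple.

(** All values of [m] are finite, so the integral is a finite sum of reals, whose limit can be taken
    term by term. *)
Lemma dominated_fine_sintegral (m : {measure set T -> \bar R}) (s : {nnsfun T >-> R}) :
  measure_le_on m sigma ->
  sintegral m s = (\sum_(x <- finmap.enum_fset (fset_set (range s)))
    x * fine (m (s @^-1` [set x])))%:E.
Proof.
move=> le_m; rewrite sintegralE fsbig_finite//= -sumEFin.
by apply: eq_bigr => x _; rewrite EFinM fineK// (dominated_fin_num le_m).
Qed.

Lemma setwise_cvg_sintegral (s : {nnsfun T >-> R}) :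
  fine (sintegral (nu i) s) @[i --> F] --> fine (sintegral mu s).
Proof.
rewrite (dominated_fine_sintegral s mu_le)/=.
suff h : (\sum_(x <- finmap.enum_fset (fset_set (range s)))
      x * fine (nu i (s @^-1` [set x])))%R @[i --> F] -->
    (\sum_(x <- finmap.enum_fset (fset_set (range s)))
      x * fine (mu (s @^-1` [set x])))%R.
  apply: cvg_trans h; apply: near_eq_cvg; apply: filterS nu_le => i le_nu.
  by rewrite (dominated_fine_sintegral s le_nu).
apply: cvg_big => [|x _]; first exact: add_continuous.
by apply: cvgMl_tmp; exact: nu_mu.
Qed.

(** The differences are integrals of the nonnegative function [h - s], which grow with the measure.
    The error of replacing [h] by [s] is thus controlled by [sigma], uniformly over the dominated
    measures. *)
Lemma dominated_integral_diff (m : {measure set T -> \bar R}) (h s : T -> R) :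
  measure_le_on m sigma -> measurable_fun setT h -> measurable_fun setT s ->
  (forall x, (0 <= s x <= h x)%R) -> \int[sigma]_x (h x)%:E < +oo ->
  (0 <= fine (\int[m]_x (h x)%:E) - fine (\int[m]_x (s x)%:E) <=
   fine (\int[sigma]_x (h x)%:E) - fine (\int[sigma]_x (s x)%:E))%R.
Proof.
move=> le_m mh ms sh hfin.
have s0 x : 0 <= (s x)%:E by rewrite lee_fin; case/andP: (sh x).
have hs0 x : 0 <= (h x - s x)%:E by rewrite lee_fin subr_ge0; case/andP: (sh x).
have mhs : measurable_fun setT (EFin \o ((h \- s)%R : T -> R)).
  by apply/measurable_EFinP; exact: measurable_funB.
have diff k : measure_le_on k sigma ->
    [/\ \int[k]_x (h x - s x)%:E \is a fin_num &
    (fine (\int[k]_x (h x)%:E) - fine (\int[k]_x (s x)%:E))%R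
      = fine (\int[k]_x (h x - s x)%:E)].
  move=> le_k.
  have hE : \int[k]_x (h x)%:E = \int[k]_x (s x)%:E + \int[k]_x (h x - s x)%:E.
    rewrite -ge0_integralD//; last exact/measurable_EFinP.
    by apply: eq_integral => x _; rewrite -EFinD addrC subrK.
  have kfin : \int[k]_x (h x)%:E < +oo.
    apply: le_lt_trans hfin; apply: ge0_le_measure_integral => //.
      by move=> x; rewrite lee_fin; case/andP: (sh x) => ? /(le_trans _); exact.
    exact/measurable_EFinP.
  have : \int[k]_x (s x)%:E + \int[k]_x (h x - s x)%:E \is a fin_num.
    by rewrite -hE ge0_fin_numE// hE adde_ge0// integral_ge0.
  rewrite fin_numD => /andP[fs fd]; split => //.
  by rewrite hE fineD// addrAC subrr add0r.
have [fm ->] := diff _ le_m; have [fs ->] := diff sigma (fun _ _ => lexx _).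
rewrite fine_ge0 ?integral_ge0//= fine_le//.
exact: ge0_le_measure_integral.
Qed.

Lemma setwise_cvg_integral (h : T -> R) : measurable_fun setT h ->
  (forall x, (0 <= h x)%R) -> \int[sigma]_x (h x)%:E < +oo ->
  fine (\int[nu i]_x (h x)%:E) @[i --> F] --> fine (\int[mu]_x (h x)%:E).
Proof.
move=> mh h0 hfin; apply/cvgrPdist_lt => e e0.
have meh : measurable_fun setT (EFin \o h) by exact/measurable_EFinP.
have eh0 x : 0 <= (EFin \o h) x by rewrite lee_fin.
pose s := nnsfun_approx measurableT meh.
have s_nd x : nondecreasing_seq (s ^~ x).
  by move=> m n mn; exact/lefP/nd_nnsfun_approx.
have s_cvg x : EFin \o s ^~ x @ \oo --> (h x)%:E.
  by apply: cvg_nnsfun_approx => //.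
have sh n x : (0 <= s n x <= h x)%R.
  rewrite fun_ge0/=.
  have := le_approx n (fun x (_ : setT x) => eh0 x) (I : setT x).
  by rewrite -(nnsfun_approxE measurableT meh) lee_fin.
have hfn : \int[sigma]_x (h x)%:E \is a fin_num.
  by rewrite ge0_fin_numE// integral_ge0// => x _; exact: eh0.
(* Monotone convergence is applied to [sigma] only; the resulting [n] serves for [mu] and for all
   [nu i] near [F]. *)
have [n hn] : exists n, (fine (\int[sigma]_x (h x)%:E) -
    fine (\int[sigma]_x (s n x)%:E) < e / 3)%R.
  have lim : sintegral sigma (s n) @[n --> \oo] --> \int[sigma]_x (h x)%:E.
    rewrite (nd_ge0_integral_lim sigma eh0 s_nd s_cvg).
    by apply: is_cvg_sintegral => // x m n /s_nd.
  rewrite -(fineK hfn) in lim; have /fine_cvg/cvgrPdist_lt := lim.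
  move=> /(_ (e / 3)%R) [|N _ /(_ N (leqnn N)) hN]; first by lra.
  by exists N; rewrite integralT_nnsfun; apply: le_lt_trans hN; exact: ler_norm.
have near_s : \forall i \near F,
   (`|fine (\int[mu]_x (s n x)%:E) - fine (\int[nu i]_x (s n x)%:E)| < e / 3)%R.
  have /cvgrPdist_lt c : fine (sintegral (nu i) (s n)) @[i --> F]
    --> fine (sintegral mu (s n)) by exact: setwise_cvg_sintegral.
  have /c : (0 < e / 3)%R by lra.
  by apply: filterS => i; rewrite !integralT_nnsfun.
near=> i.
have le_nu : measure_le_on (nu i) sigma by near: i.
have := dominated_integral_diff mu_le mh _ (sh n) hfin.
have := dominated_integral_diff le_nu mh _ (sh n) hfin.
have : (`|fine (\int[mu]_x (s n x)%:E) - fine (\int[nu i]_x (s n x)%:E)| < e / 3)%R.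
  by near: i.
have ms : measurable_fun setT (s n : T -> R) by [].
(* Three errors below [e / 3]: from [h] to [s n] under [mu], from [mu] to [nu i] on [s n], and from
   [s n] back to [h] under [nu i]. *)
rewrite !ltr_norml => /andP[? ?] /(_ ms)/andP[? ?] /(_ ms)/andP[? ?].
apply/andP; split; lra.
Unshelve. all: by end_near. Qed.

End SetwiseLimit.

(** * Regularity, vague convergence and compactness for a single measure *)

Section RadonDominated.
Context (R : realType) (X : ptopologicalType).
Hypothesis hausX : hausdorff_space X.

Lemma open_borel (U : set X) : open U -> measurable (U : set (borel X)).
Proof. by move=> oU; exact: sub_sigma_algebra. Qed.

Lemma compact_borel (K : set X) : compact K -> measurable (K : set (borel X)).
Proof.
move=> /(compact_closed hausX) cK; rewrite -(setCK K); apply: measurableC.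
by apply: open_borel; exact: closed_openC.
Qed.

Lemma continuous_borel (f : X -> R) :
  continuous f -> measurable_fun setT (f : borel X -> R).
Proof.
move=> /continuousP cf; apply: (measurability _ (RGenOpens.measurableE R)).
move=> _ [_ [a [b ->] <-]]; rewrite setTI; apply: open_borel.
exact/cf/interval_open.
Qed.

(** An open superset or compact subset that approximates within [e] for [sigma] does so for [mu], by
    [dominated_diff]. *)
Lemma dominated_is_radon (sigma : radonMeasure R X)
    (mu : {measure set (borel X) -> \bar R}) :
  sigma setT < +oo -> measure_le_on mu sigma -> is_radon mu.
Proof.
move=> sfin le_mu.
have mfin B : measurable B -> mu B \is a fin_num.
  exact: dominated_fin_num le_mu sfin.
have sigma_fin B : measurable B -> sigma B \is a fin_num.
  by apply: dominated_fin_num sfin => C _.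
split.
- by move=> K /compact_borel mK; rewrite ltey_eq mfin.
- move=> B mB; apply/eqP; rewrite eq_le; apply/andP; split.
    apply: le_ereal_inf_tmp => _ [U [oU BU] <-].
    by rewrite le_measure ?inE//; exact: open_borel.
  apply/lee_addgt0Pr => e e0.
  have sBE := radon_outer_regular (radonP sigma) mB.
  have [|_ [U [oU BU] <-]] := @lb_ereal_inf_adherent _ [set sigma U |
    U in [set U : set X | open U /\ B `<=` U]] e e0; rewrite -sBE ?sigma_fin// => sU.
  have mU := open_borel oU.
  apply: (@le_trans _ _ (mu U)); first by apply: ereal_inf_lbound; exists U.
  have := dominated_diff le_mu sfin mB mU BU.
  rewrite leeBlDl ?mfin// => /le_trans; apply.
  by rewrite leeD2l// leeBlDl ?sigma_fin// ltW.
- move=> U oU; have mU := open_borel oU.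
  apply/eqP; rewrite eq_le; apply/andP; split; last first.
    apply: ge_ereal_sup => _ [K [cK KU] <-].
    by rewrite le_measure ?inE//; exact: compact_borel.
  apply/lee_addgt0Pr => e e0.
  have sUE := radon_inner_regular (radonP sigma) oU.
  have [|_ [K [cK KU] <-]] := @ub_ereal_sup_adherent _ [set sigma K |
    K in [set K : set X | compact K /\ K `<=` U]] e e0; rewrite -sUE ?sigma_fin// => sK.
  have mK := compact_borel cK.
  apply: (@le_trans _ _ (mu K + e%:E)); last first.
    by rewrite leeD2r//; apply: ereal_sup_ubound; exists K.
  have := dominated_diff le_mu sfin mK mU KU.
  rewrite leeBlDl ?mfin// => /le_trans; apply.
  rewrite leeD2l// leeBlDl ?sigma_fin//.
  by rewrite lteBlDr// in sK; exact: ltW.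
Qed.

Lemma vague_cvg (F : set_system (radonMeasure R X)) (mu : radonMeasure R X) :
  Filter F ->
  (forall f : Cc R X, radon_eval nu f @[nu --> F] --> radon_eval mu f) ->
  F --> mu.
Proof.
move=> FF cvF.
have cvE : @radon_eval R X @ F --> radon_eval mu.
  (* The product topology is the supremum of the initial topologies of the evaluations at [f]. Each
     evaluation is surjective, as constant families show. *)
  apply/cvg_sup => f; apply/cvg_image.
    by rewrite eqEsubset; split=> // r _; exists (fun _ => r).
  move=> V /cvF FV; exists ((fun h : Cc R X -> R => h f) @^-1` V) => //.
  by rewrite image_preimage// eqEsubset; split=> // r _; exists (fun _ => r).
move=> V [_ [[W oW <-] Wmu WV]]; apply: filterS WV _.
by apply: cvE; exact: open_nbhs_nbhs.
Qed.

Lemma Cc_bounded (f : Cc R X) : exists M : R, forall x, (`|sval f x| <= M)%R.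
Proof.
case: f => f [cf cK] /=.
have : compact (f @` closure [set x | f x != 0%R]).
  by apply: continuous_compact => //; exact: continuous_subspaceT.
move=> /compact_bounded[M [_ /(_ (`|M| + 1)%R) Mb]].
(* A bound is available for every constant strictly above [M]; the absolute value keeps it
   nonnegative where [f] vanishes. *)
exists (`|M| + 1)%R => x.
have [->|fx0] := eqVneq (f x) 0%R; first by rewrite normr0; have := normr_ge0 M; lra.
apply: Mb; first by have := ler_norm M; lra.
by exists x => //; exact: subset_closure.
Qed.

Lemma bounded_integral_lty (sigma : {measure set (borel X) -> \bar R})
    (h : X -> R) (M : R) : sigma setT < +oo -> measurable_fun setT (h : borel X -> R) ->
  (forall x, (0 <= h x <= M)%R) -> \int[sigma]_x (h x)%:E < +oo.
Proof.
move=> sfin mh hM.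
have M0 : (0 <= M)%R by case/andP: (hM point) => /le_trans; exact.
apply: (@le_lt_trans _ _ (\int[sigma]_x (cst M%:E) x)).
  apply: ge0_le_integral => //.
  - by move=> x _; rewrite lee_fin; case/andP: (hM x).
  - exact/measurable_EFinP.
  - by move=> x _; rewrite lee_fin; case/andP: (hM x).
by rewrite integral_cst// lte_mul_pinfty.
Qed.

Lemma dominated_radon_compact (sigma : radonMeasure R X) (A : set X)
    (g : X -> R) (a : R) :
  sigma setT < +oo -> continuous g -> (forall x, (0 <= g x)%R) ->
  \int[sigma]_x (g x)%:E < +oo -> radon_support sigma `<=` A ->
  compact [set mu : radonMeasure R X | radon_support mu `<=` A /\
    radon_le mu sigma /\ \int[mu]_x (g x)%:E = a%:E].
Proof.
move=> sfin cg g0 gfin sA; rewrite compact_ultra => F FU FK.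
have FP : ProperFilter F by exact: ultra_proper.
have Fle : \forall nu \near F, measure_le_on (radon_measure nu) sigma.
  by apply: filterS FK => nu [_ [le_nu _]].
have [mu le_mu cv_mu] := ultra_setwise_limit sfin FU Fle.
have cvI := setwise_cvg_integral sfin FP Fle le_mu cv_mu.
have mg := continuous_borel cg.
exists (RadonMeasure (dominated_is_radon sfin le_mu)); split; [split; [|split]|] => /=.
(* An open set charged by [mu] is charged by [sigma], so the support of [mu] lies in that of
   [sigma]. *)
- move=> x xmu; apply: sA => U oU; apply: lt_le_trans (xmu U oU) _.
  exact: (le_mu _ (open_borel (proj1 oU))).
- exact: le_mu.
- have cvga := cvI g mg g0 gfin.
  have : fine (\int[mu]_x (g x)%:E) = a.
    apply: (cvg_unique _ cvga) => //.
    apply: cvg_trans (cvg_cst (F := F) a); apply: near_eq_cvg.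
    by apply: filterS FK => nu [_ [_ ->]].
  (* Finiteness must be checked before removing [fine], which sends infinite values to 0; it follows
     from the integral against [sigma]. *)
  move=> <-; rewrite fineK// ge0_fin_numE ?integral_ge0//; last first.
    by move=> x _; rewrite lee_fin.
  apply: le_lt_trans gfin; apply: ge0_le_measure_integral => //.
  exact/measurable_EFinP.
(* Convergence of integrals is known for nonnegative [sigma]-integrable functions, so [f] is split
   into its positive and negative parts, bounded and hence integrable for the finite [sigma]. *)
- apply: vague_cvg => f.
  have [M fM] := Cc_bounded f.
  have mf : measurable_fun setT (sval f : borel X -> R).
    by apply: continuous_borel; case: (svalP f).
  have pM x : (0 <= (sval f)^\+ x <= M)%R.
    rewrite funrpos_ge0 ge_max (le_trans (ler_norm _) (fM x))/=.
    exact: le_trans (fM x).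
  have nM x : (0 <= (sval f)^\- x <= M)%R.
    rewrite funrneg_ge0 ge_max (le_trans (normr_ge0 _) (fM x)) andbT.
    by rewrite (le_trans _ (fM x))// -normrN ler_norm.
  have mp := measurable_funrpos mf; have mn := measurable_funrneg mf.
  have pfin := bounded_integral_lty sfin mp pM.
  have nfin := bounded_integral_lty sfin mn nM.
  have fin (nu : {measure set (borel X) -> \bar R}) (h : X -> R) :
      measure_le_on nu sigma -> measurable_fun setT (h : borel X -> R) ->
      (forall x, (0 <= h x <= M)%R) -> \int[nu]_x (h x)%:E \is a fin_num.
    move=> le_nu mh hM; rewrite ge0_fin_numE; last first.
      by apply: integral_ge0 => x _; rewrite lee_fin; case/andP: (hM x).
    apply: bounded_integral_lty mh hM; apply: le_lt_trans sfin; exact: le_nu.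
  have decomp (nu : {measure set (borel X) -> \bar R}) : measure_le_on nu sigma ->
      (\int[nu]_x sval f x = fine (\int[nu]_x ((sval f)^\+ x)%:E) -
                             fine (\int[nu]_x ((sval f)^\- x)%:E))%R.
    move=> le_nu; rewrite /Rintegral integralE -fineB ?fin//.
    by rewrite (funerpos (sval f)) (funerneg (sval f)).
  rewrite /radon_eval/= decomp//.
  have cvp := cvI _ mp (fun x => funrpos_ge0 (sval f) x) pfin.
  have cvn := cvI _ mn (fun x => funrneg_ge0 (sval f) x) nfin.
  apply: cvg_trans (cvgB cvp cvn); apply: near_eq_cvg.
  by apply: filterS Fle => nu le_nu; rewrite decomp.
Qed.

End RadonDominated.

(** * Families of measures: reduction to the components *)

Theorem lemma5p8 (R : realType) (X : ptopologicalType)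
  (hausX : hausdorff_space X) (lcX : locally_compact [set: X])
  (kappa : X * X -> \bar R) (kerk : is_kernel kappa)
  (spdk : strictly_positive_definite kappa)
  (I : finType) (A : I -> set X) (s : I -> int)
  (condA : generalized_condenser kappa A s)
  (a : I -> R) (a_gt0 : forall i, (0 < a i)%R)
  (g : I -> X -> R) (g_gt0 : forall i x, (0 < g i x)%R)
  (g_cont : forall i, continuous (g i))
  (g_inf : forall i, (0 < inf (range (g i)))%R)
  (sigma : radonFamily R X I) (sigmaC : constraints A a g sigma)
  (sigma_fin : forall i, \int[sigma i]_x (g i x)%:E < +oo) :
  compact (constrained_measures A a g sigma).
Proof.
have [_ sigmaP] := sigmaC.
(* The positive number [inf (range (g i))] times the total mass is at most the finite integral of
   [g i]. *)
have mass_fin i : sigma i setT < +oo.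
  have inf_g x : (inf (range (g i)) <= g i x)%R.
    by apply: ge_inf; [exists 0%R => _ [y _ <-]; exact/ltW|exists x].
  rewrite -(lte_pmul2l (z := (inf (range (g i)))%:E)) ?lte_fin//.
  rewrite mulry gtr0_sg// mul1e.
  rewrite -integral_cst//; apply: le_lt_trans (sigma_fin i).
  apply: ge0_le_integral => //.
  - by move=> x _; rewrite lee_fin ltW.
  - by apply/measurable_EFinP; exact: continuous_borel.
  - by move=> x _; rewrite lee_fin.
have cK i : compact [set mu : radonMeasure R X | radon_support mu `<=` A i /\
    radon_le mu (sigma i) /\ \int[mu]_x (g i x)%:E = (a i)%:E].
  apply: dominated_radon_compact => //.
  - by move=> x; exact/ltW.
  - by have [_ ->] := sigmaP i.
(* All conditions are componentwise, so the set of families is the product of the compact sets in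
   [cK]. *)
have := tychonoff cK; congr (compact _).
rewrite eqEsubset; split=> mu.
- by move=> h; split=> i; have [] := h i.
- by move=> [h1 h2] i; split; [exact: h1|exact: h2].
Qed.
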